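(* Let $s(x)=x^2$. For every positive integer $L$ there exists $\hat s_L\in\widehat{\mathcal N}_L^{3}$ (with input dimension $d=1$) such that $$\|\hat s_L-s\|_{L^\infty([-1,1])}=2^{-2L}\quad\text{and}\quad |\hat s_L-s|_{W^{1,\infty}(-1,1)}\le 2^{-(L-1)}.$$
   Context: Let $\sigma(t)=\mathrm{ReLU}(t)=\max\{0,t\}$, applied componentwise to vectors. For positive integers $d,L,N$, the class $\widehat{\mathcal N}_L^N$ (with input dimension $d$) is the set of functions $f:\mathbb R^d\to\mathbb R$ of the form $f^1(x)=\sigma(\widehat\theta^1(x))$, $f^\ell(x)=\sigma(\widehat\theta^\ell([x,f^{\ell-1}(x)]))$ for $\ell=2,\dots,L$, and $f(x)=\widehat\theta^{L+1}([x,f^1(x),\dots,f^L(x)])$, where $[\cdot,\cdot]$ denotes concatenation of vectors, $f^\ell(x)\in\mathbb R^N$ for $\ell=1,\dots,L$, and $\widehat\theta^1:\mathbb R^d\to\mathbb R^N$, $\widehat\theta^\ell:\mathbb R^{d+N}\to\mathbb R^N$ ($2\le\ell\le L$), $\widehat\theta^{L+1}:\mathbb R^{d+LN}\to\mathbb R$ are arbitrary affine maps. The seminorm $|v|_{W^{1,\infty}(-1,1)}$ is $\|v'\|_{L^\infty(-1,1)}$. *)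

(* Defs.v *)
From HB Require Import structures.
From mathcomp Require Import all_boot all_order all_algebra.
From mathcomp Require Import all_classical all_reals all_analysis.

Set Implicit Arguments.
Unset Strict Implicit.
Unset Printing Implicit Defensive.
Import Order.TTheory GRing.Theory Num.Theory.
Import numFieldNormedType.Exports.

Local Open Scope classical_set_scope.
Local Open Scope ring_scope.

Definition relu (R : realType) (n : nat) (v : 'rV[R]_n) : 'rV[R]_n :=
  map_mx (fun t => Num.max 0 t) v.

Definition affine_map (R : realType) (m n : nat) (f : 'rV[R]_m -> 'rV[R]_n) :=
  exists (W : 'M[R]_(m, n)) (b : 'rV[R]_n), forall x, f x = x *m W + b.

(* Layers are counted from 0: [hidden theta1 theta x l] is f^(l+1)(x), and
   [theta l] is the affine map entering f^(l+2). *)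
Fixpoint hidden (R : realType) (d N : nat) (theta1 : 'rV[R]_d -> 'rV[R]_N)
    (theta : nat -> 'rV[R]_(d + N) -> 'rV[R]_N) (x : 'rV[R]_d) (l : nat)
    : 'rV[R]_N :=
  if l is l'.+1
  then relu (theta l' (row_mx x (hidden theta1 theta x l')))
  else relu (theta1 x).

(* [mxvec] is row-major, so the [mxvec] below is the concatenation of
   f^1(x), ..., f^L(x), of width L * N. *)
Definition Nhat (R : realType) (d L N : nat) : set ('rV[R]_d -> R) :=
  [set f | exists (theta1 : 'rV[R]_d -> 'rV[R]_N)
      (theta : nat -> 'rV[R]_(d + N) -> 'rV[R]_N)
      (thetaout : 'rV[R]_(d + L * N) -> 'rV[R]_1),
    [/\ affine_map theta1,
        (forall l, (l.+1 < L)%N -> affine_map (theta l)),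
        affine_map thetaout &
        forall x, f x = thetaout (row_mx x
          (mxvec (\matrix_(l < L) hidden theta1 theta x l))) 0 0]].

Arguments Nhat R d L N : clear implicits.

Definition Linfty_norm (R : realType) (i : interval R) (f : R -> R) : \bar R :=
  ('N[mrestr lebesgue_measure (measurable_itv i)]_+oo[EFin \o f])%E.

(* C^oo functions with compact support inside the open interval ]a, b[ *)
Definition test_function (R : realType) (a b : R) (phi : R -> R) : Prop :=
  [/\ (forall (n : nat) (x : R), derivable (phi^`(n))%classic x 1),
      compact (closure [set x | phi x != 0]) &
      closure [set x | phi x != 0] `<=` `]a, b[%classic].

Definition weak_derivative (R : realType) (a b : R) (v g : R -> R) : Prop :=
  [/\ locally_integrable `]a, b[%classic v,
      locally_integrable `]a, b[%classic g &
      forall phi, test_function a b phi ->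
        (\int[lebesgue_measure]_(x in `]a, b[) (v x * (phi^`())%classic x)%:E =
         - \int[lebesgue_measure]_(x in `]a, b[) (g x * phi x)%:E)%E].

(* The seminorm |v|_{W^{1,oo}(a,b)}. Weak derivatives are unique up to null
   sets, so the infimum ranges over at most one value; it is +oo if v has no
   weak derivative on ]a, b[. *)
Definition W1oo_seminorm (R : realType) (a b : R) (v : R -> R) : \bar R :=
  ereal_inf [set Linfty_norm `]a, b[ g | g in weak_derivative a b v].

(* Main.v *)
Require Import Defs.
From mathcomp Require Import all_boot all_order all_algebra.
From mathcomp Require Import all_classical all_reals all_analysis.
From mathcomp Require Import measurable_realfun ess_sup_inf ring lra.
Import Order.TTheory GRing.Theory Num.Theory.
Import numFieldNormedType.Exports.

Local Open Scope classical_set_scope.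
Local Open Scope ring_scope.

Local Notation mu := lebesgue_measure.

(** The network computes the piecewise linear interpolant of [x ^+ 2] on the
    dyadic grid of mesh [2 ^- m], with [m = L - 1].

    Let [tent] be the map [0, 1] -> [0, 1] equal to [2 t] on the left half and
    to [2 - 2 t] on the right half, and let [saw m x] be its [m]-th iterate at
    [`|x|]. On [0, 1] the tent map satisfies
    [t (1 - t) - tent t / 4 = tent t (1 - tent t) / 4], so subtracting
    [4 ^- l * saw l] from [`|x|] for [l = 1, ..., m] telescopes to
    [x ^+ 2 + 4 ^- m * saw m x * (1 - saw m x)] ([approx_error]).

    The network needs nothing but this recursion. [tent] is a combination of
    two ReLUs and [`|x|] is one too, so each layer produces the next iterate
    up to a fixed linear readout, and the output layer, which sees all
    layers, forms the weighted sum ([approx_Nhat]).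

    The error is at most [4 ^- m / 4 = 2 ^- (2 * L)] since [s (1 - s) <= 1/4],
    and is within any [e] of that bound on a small interval ending at
    [2 ^- m / 2], hence the equality of the essential supremum
    ([approx_Linfty]).

    For the derivative, [tent] reduces its argument modulo sign and integer
    translations, so [saw m x] is [2 ^+ m * x] folded into [0, 1]; on a
    dyadic cell [[a, b]] the error is therefore exactly [(x - a) * (b - x)]
    ([saw_bump]). These parabolic arcs vanish at the nodes, so integrating by
    parts on each cell leaves no boundary term, and the sum over the cells
    shows that the cellwise slope [a + b - 2 x] is the weak derivative
    ([slope_weak_derivative]). It is bounded by the mesh size
    [2 ^- m = 2 ^- (L - 1)]. *)

(** * Iterates of the tent map *)

Definition tent (R : realType) (t : R) : R :=
  2 * Num.max 0 t - 4 * Num.max 0 (t - 2^-1).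

Definition saw (R : realType) (m : nat) (x : R) : R := iter m (@tent R) `|x|.

Definition approx (R : realType) (m : nat) (x : R) : R :=
  `|x| - \sum_(l < m) 4 ^- l.+1 * saw R l.+1 x.

Lemma tentE (R : realType) (t : R) : 0 <= t <= 1 ->
  (t <= 2^-1 /\ tent R t = 2 * t) \/ (2^-1 <= t /\ tent R t = 2 - 2 * t).
Proof.
move=> /andP[t0 t1]; rewrite /tent.
rewrite (max_r t0).
by case: (lerP 0 (t - 2^-1)) => ht; [right|left]; split; lra.
Qed.

Lemma sawS (R : realType) (m : nat) (x : R) :
  saw R m.+1 x = tent R (saw R m x).
Proof. by []. Qed.

(** The tent map sends [0, 1] to itself, so that only its two affine branches
    over [0, 1] ever come into play. *)
Lemma saw_itv (R : realType) (m : nat) (x : R) :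
  `|x| <= 1 -> 0 <= saw R m x <= 1.
Proof.
move=> x1; elim: m => [|m IH]; first by rewrite /saw /= normr_ge0.
have [[? e]|[? e]] := tentE R _ IH; move/andP: IH => [? ?];
  by rewrite sawS e; apply/andP; split; lra.
Qed.

(** Both branches of the tent map, [2 t] and [2 - 2 t], carry [+- z + integer]
    to [+- 2 z + integer]. *)
Lemma saw_fold (R : realType) (m : nat) (x : R) : `|x| <= 1 ->
  exists k : int, saw R m x = 2 ^+ m * x - k%:~R \/
                  saw R m x = k%:~R - 2 ^+ m * x.
Proof.
move=> x1; elim: m => [|m [k IH]].
  exists 0; rewrite /saw /= expr0 mul1r subr0 sub0r.
  by have [_|_] := ger0P x; [left|right].
rewrite sawS; have [[_ ->]|[_ ->]] := tentE R _ (saw_itv R m x x1).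
  exists (2 * k); rewrite intrM exprS.
  by case: IH => ->; [left|right]; ring.
case: IH => ->; [exists (2 * k + 2); right|exists (2 * k - 2); left];
  rewrite ?(intrD, intrB, intrM) exprS; ring.
Qed.

(** By [saw_fold], [saw m x] is a point of [0, 1] congruent to [+- 2 ^+ m * x]
    modulo integers, and [s (1 - s)] is invariant under [s -> 1 - s]. Only at
    an end of the cell can the integer of [saw_fold] differ from the expected
    one, and there both sides are zero. *)
Lemma saw_bump (R : realType) (m : nat) (x : R) (j : int) : `|x| <= 1 ->
  j%:~R <= 2 ^+ m * x <= j%:~R + 1 ->
  saw R m x * (1 - saw R m x)
    = (2 ^+ m * x - j%:~R) * (j%:~R + 1 - 2 ^+ m * x).
Proof.
move=> x1 /andP[]; have /andP[] := saw_itv R m x x1.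
have [k] := saw_fold R m x x1.
move: (2 ^+ m * x) (saw R m x) => z y hy y0 y1 jz zj.
case: hy => hy.
- have [jk|jk|jk] := ltgtP j k; last by rewrite hy -jk; ring.
    have {}jk : (j%:~R + 1 : R) <= k%:~R.
      by rewrite -(intrD _ j 1) ler_int lezD1.
    have -> : y = 0 by lra.
    have -> : z = j%:~R + 1 by lra.
    by ring.
  have {}jk : (k%:~R + 1 : R) <= j%:~R.
    by rewrite -(intrD _ k 1) ler_int lezD1.
  have -> : y = 1 by lra.
    have -> : z = j%:~R by lra.
    by ring.
- have [jk|jk|jk] := ltgtP (j + 1) k; last by rewrite hy -jk intrD; ring.
    have {}jk : (j%:~R + 1 + 1 : R) <= k%:~R.
      by rewrite -(intrD _ j 1) -(intrD _ _ 1) ler_int lezD1.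
    have -> : y = 1 by lra.
    have -> : z = j%:~R + 1 by lra.
    by ring.
  have {}jk : (k%:~R : R) <= j%:~R by rewrite ler_int -ltzD1.
  have -> : y = 0 by lra.
    have -> : z = j%:~R by lra.
    by ring.
Qed.

(** The identity [t (1 - t) - tent t / 4 = tent t (1 - tent t) / 4], valid on
    each branch of the tent map, makes the sum telescope. *)
Lemma approx_error (R : realType) (m : nat) (x : R) : `|x| <= 1 ->
  approx R m x - x ^+ 2 = 4 ^- m * (saw R m x * (1 - saw R m x)).
Proof.
move=> x1; rewrite -(real_normK (num_real x)).
elim: m => [|m IH]; first by rewrite /approx big_ord0 expr0 invr1 /saw /=; ring.
have -> : approx R m.+1 x = approx R m x - 4 ^- m.+1 * saw R m.+1 x.
  by rewrite /approx big_ord_recr /=; ring.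
rewrite addrAC IH exprS invfM sawS.
by have [[_ ->]|[_ ->]] := tentE R _ (saw_itv R m x x1);
  field; rewrite expf_neq0.
Qed.

(** * The network *)

(** The entries are chosen so that one linear form recovers the iterates from
    every layer: [2 a - 4 b] is the tent map when [a], [b] are the ReLUs of
    [t], [t - 1/2], and [2 a + 2 c] is [`|x|] when [a], [c] are those of
    [x / 2], [- x / 2]. *)
Definition readout (R : realType) : 'cV[R]_3 :=
  \col_j [:: 2; -4; 2]`_j.

Definition layer1 (R : realType) (x : 'rV[R]_1) : 'rV[R]_3 :=
  x *m (\row_j [:: 2^-1; 0; - 2^-1]`_j).

Definition layer (R : realType) (v : 'rV[R]_(1 + 3)) : 'rV[R]_3 :=
  v *m (col_mx 0 (readout R *m \row_j [:: 1; 1; 0]`_j))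
  + \row_j [:: 0; - 2^-1; 0]`_j.

Lemma readoutE (R : realType) (v : 'rV[R]_3) :
  (v *m readout R) 0 0 = 2 * v 0 0 - 4 * v 0 1 + 2 * v 0 2%:R.
Proof.
rewrite !mxE !big_ord_recr big_ord0 /= !mxE /= add0r.
have -> : widen_ord (leqnSn 2) (widen_ord (leqnSn 1) ord_max) = 0.
  exact: val_inj.
have -> : widen_ord (leqnSn 2) ord_max = 1 by exact: val_inj.
have -> : ord_max = 2%:R :> 'I_3 by exact: val_inj.
ring.
Qed.

Lemma readout_layer1 (R : realType) (x : R) :
  (relu (layer1 R (const_mx x)) *m readout R) 0 0 = `|x|.
Proof.
rewrite readoutE !mxE !big_ord_recr !big_ord0 /= !mxE /=.
rewrite !add0r mulr0 maxxx mulrN.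
have [x0|x0] := ger0P x.
  by rewrite max_r ?max_l; lra.
by rewrite max_l ?max_r; lra.
Qed.

Lemma readout_layer (R : realType) (x : 'rV[R]_1) (v : 'rV[R]_3) :
  (relu (layer R (row_mx x v)) *m readout R) 0 0
    = tent R ((v *m readout R) 0 0).
Proof.
rewrite readoutE /layer mul_row_col mulmx0 add0r mulmxA.
rewrite [v *m readout R]mx11_scalar mul_scalar_mx !mxE /= /tent.
rewrite !(mulr1, mulr0, addr0, add0r) maxxx; ring.
Qed.

Lemma readout_hidden (R : realType) (x : R) (l : nat) :
  (hidden (layer1 R) (fun=> layer R) (const_mx x) l *m readout R) 0 0
    = saw R l x.
Proof.
elim: l => [|l IH]; first exact: readout_layer1.
by rewrite [hidden _ _ _ _]/= readout_layer IH.
Qed.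

Lemma mxvec_dot (R : comPzRingType) (m n : nat) (A B : 'M[R]_(m, n)) :
  (mxvec A *m (mxvec B)^T) 0 0 = \sum_i \sum_j A i j * B i j.
Proof.
rewrite mxE pair_bigA (reindex _ (curry_mxvec_bij m n)).
by apply: eq_bigr => -[i j] _; rewrite mxE !mxvecE.
Qed.

(** The coefficients of [saw l] in [approx]; the [0]-th iterate is [`|x|]. *)
Definition weight (R : realType) (l : nat) : R :=
  if l is 0 then 1 else - 4 ^- l.

Definition output (R : realType) (m : nat) (v : 'rV[R]_(1 + m.+1 * 3)) :
    'rV[R]_1 :=
  v *m col_mx 0 (mxvec (\matrix_(l < m.+1, j < 3)
                          (weight R l * readout R j 0)))^T.

Lemma output_hidden (R : realType) (m : nat) (x : R) :
  output R m (row_mx (const_mx x) (mxvec (\matrix_(l < m.+1)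
    hidden (layer1 R) (fun=> layer R) (const_mx x) l))) 0 0 = approx R m x.
Proof.
rewrite /output mul_row_col mulmx0 add0r mxvec_dot.
transitivity (\sum_(l < m.+1) weight R l * saw R l x).
  apply: eq_bigr => l _; rewrite -readout_hidden [in RHS]mxE mulr_sumr.
  by apply: eq_bigr => j _; rewrite !mxE mulrCA.
rewrite big_ord_recl /= mul1r /approx -sumrN; congr (_ + _).
by apply: eq_bigr => l _; rewrite mulNr.
Qed.

Lemma approx_Nhat (R : realType) (m : nat) :
  Nhat R 1 m.+1 3 (fun x => approx R m (x 0 0)).
Proof.
exists (layer1 R), (fun=> layer R), (output R m); split.
- by eexists; exists 0 => x; rewrite addr0.
- by move=> l _; do 2 eexists.
- by eexists; exists 0 => x; rewrite addr0.
- move=> x; rewrite [x in RHS](_ : x = const_mx (x 0 0)) ?output_hidden //.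
  by apply/rowP => i; rewrite (ord1 i) mxE.
Qed.

(** * The uniform error *)

Lemma tent_continuous (R : realType) : continuous (@tent R).
Proof.
move=> t.
have cmax (c : R) : Num.max 0 (u - c) @[u --> t] --> Num.max 0 (t - c).
  apply: (@continuous_max R _ (fun=> 0) (fun u => u - c)) => //.
    exact: cvg_cst.
  by apply: cvgB; [exact: cvg_id|exact: cvg_cst].
rewrite /tent; apply: cvgB; apply: cvgM; (try exact: cvg_cst); last exact: cmax.
by have := cmax 0; rewrite subr0; under eq_cvg do rewrite subr0.
Qed.

Lemma saw_continuous (R : realType) (m : nat) : continuous (saw R m).
Proof.
elim: m => [|m IH] x; first exact: norm_continuous.
exact: (continuous_comp (IH x) (@tent_continuous R _)).
Qed.

Lemma approx_continuous (R : realType) (m : nat) : continuous (approx R m).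
Proof.
move=> x; apply: cvgB; first exact: norm_continuous.
apply: cvg_big => [|l _]; first exact: add_continuous.
by apply: cvgM; [exact: cvg_cst|exact: saw_continuous].
Qed.

Lemma Linfty_norm_le (R : realType) (i : interval R) (f : R -> R) (c : R) :
  0 <= c -> (forall x, x \in i -> `|f x| <= c) -> (Linfty_norm i f <= c%:E)%E.
Proof.
move=> c0 fc; rewrite /Linfty_norm unlock.
case: ifPn => _; last by rewrite lee_fin.
apply/ess_supP; exists (~` [set` i]); split.
- exact: measurableC.
- by rewrite /= /mrestr setICl measure0.
- by move=> x /=; apply: contra_not => xi; rewrite lee_fin fc.
Qed.

(** A lower bound on a subset of positive measure passes to the essential
    supremum; a lower bound at a single point would not. *)
Lemma Linfty_norm_ge (R : realType) (i j : interval R) (f : R -> R) (c : R) :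
  [set` j] `<=` [set` i] -> (0 < lebesgue_measure [set` j])%E ->
  (forall x, x \in j -> c <= `|f x|) -> (c%:E <= Linfty_norm i f)%E.
Proof.
move=> ji j0 fc; rewrite /Linfty_norm unlock.
rewrite ifT; last first.
  rewrite /= /mrestr setTI (lt_le_trans j0) // le_measure ?inE //.
rewrite leNgt; apply/negP => lt_c.
have [N [mN N0 subN]] :=
  ess_sup_ge (mrestr mu (measurable_itv i)) (abse \o (EFin \o f)).
move: j0; apply/negP; rewrite -leNgt -N0 /= /mrestr.
apply: le_measure; rewrite ?inE //.
  exact: measurableI.
move=> x xj; split; last exact: ji.
apply: subN => /= le_f.
have := le_lt_trans le_f lt_c; rewrite lte_fin ltNge; exact/negP/negPn/fc.
Qed.

(** The supremum is attained where [saw m x = 1/2], for instance at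
    [x = 2 ^- m / 2]. *)
Lemma approx_Linfty (R : realType) (m : nat) :
  Linfty_norm `[-1, 1] (fun x => approx R m x - x ^+ 2)
    = (2 ^- (2 * m.+1))%:E.
Proof.
have -> : 2 ^- (2 * m.+1) = 4 ^- m / 4 :> R.
  by rewrite mulnS exprD invfM mulrC exprM (_ : 2 ^+ 2 = 4) //; ring.
have m0 : 0 < 4 ^- m :> R by rewrite invr_gt0 exprn_gt0.
apply/eqP; rewrite eq_le; apply/andP; split.
  apply: Linfty_norm_le; first by rewrite divr_ge0 // ltW.
  move=> x; rewrite in_itv /= -ler_norml => x1.
  rewrite approx_error // normrM (gtr0_norm m0) ler_pM2l //.
  have /andP[s0 s1] := saw_itv R m x x1; rewrite ger0_norm.
    by have := sqr_ge0 (saw R m x - 2^-1); lra.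
  by apply: mulr_ge0; lra.
apply/lee_addgt0Pr => e e0.
have h0 : 0 < 2 ^- m :> R by rewrite invr_gt0 exprn_gt0.
have h1 : 2 ^- m <= 1 :> R.
  by rewrite invf_le1 ?exprn_gt0 // exprn_ege1 // ler1n.
(* With [z = 2 ^+ m * x] in [[1/2 - d, 1/2]], the error falls short of its
   maximum by [4 ^- m * (1/2 - z)^2 <= d ^+ 2 <= d <= e]. *)
pose d := Num.min 2^-1 e.
have d0 : 0 < d by rewrite lt_min e0 andbT; lra.
have d1 : d <= 2^-1 by rewrite ge_min lexx.
have de : d <= e by rewrite ge_min lexx orbT.
rewrite -leeBlDr // -EFinB.
apply: (@Linfty_norm_ge _ _ `[2 ^- m * (2^-1 - d), 2 ^- m * 2^-1]).
- move=> x /=; rewrite !in_itv /= => /andP[lx xu].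
  have : 0 <= 2 ^- m * (2^-1 - d) by rewrite mulr_ge0 ?subr_ge0 // ltW.
  by move=> ?; apply/andP; split; lra.
- rewrite lebesgue_measure_itv /= lte_fin ltr_pM2l // ifT; last lra.
  by rewrite -EFinB lte_fin -mulrBr mulr_gt0 //; lra.
- move=> x; rewrite in_itv /= => /andP[lx xu].
  have lx0 : 0 <= 2 ^- m * (2^-1 - d) by rewrite mulr_ge0 ?subr_ge0 // ltW.
  have x1 : `|x| <= 1 by rewrite ler_norml; apply/andP; split; lra.
  move: lx xu; rewrite ler_pdivrMl ?ler_pdivlMl ?exprn_gt0 // => lx xu.
  rewrite approx_error // (saw_bump _ _ _ 0 x1) ?mulr0z; last first.
    by apply/andP; split; lra.
  move: (2 ^+ m * x) lx xu => z lz zu.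
  rewrite subr0 add0r ger0_norm; last first.
    by apply: mulr_ge0; [exact: ltW|apply: mulr_ge0; lra].
  have m1 : 4 ^- m <= 1 :> R.
    by rewrite invf_le1 ?exprn_gt0 // exprn_ege1 // ler1n.
  have z0 : 0 <= 2^-1 - z by lra.
  have zd : 2^-1 - z <= d by lra.
  have : 4 ^- m * ((2^-1 - z) * (2^-1 - z)) <= 1 * (d * 1).
    apply: ler_pM => //; first exact: mulr_ge0.
    by apply: ler_pM => //; lra.
  rewrite !mul1r mulr1; lra.
Qed.

(** * The weak derivative of the error *)

Lemma derivable_continuous (R : realType) (f : R -> R) :
  (forall x, derivable f x 1) -> continuous f.
Proof. by move=> df x; apply/differentiable_continuous/derivable1_diffP. Qed.

(** The arc vanishes at both ends, which kills the boundary terms. The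
    half-open interval suits the gluing below, and the finiteness claim is
    what lets the opposites be summed in the extended reals. *)
Lemma arc_ibp (R : realType) (a b : R) (phi : R -> R) : a < b ->
  (forall x, derivable phi x 1) -> continuous (phi^`())%classic ->
  (\int[mu]_(x in `[a, b[) ((a + b - 2 * x) * phi x)%:E
   \is a fin_num)%E /\
  (\int[mu]_(x in `[a, b[) ((x - a) * (b - x) * (phi^`())%classic x)%:E
   = - \int[mu]_(x in `[a, b[) ((a + b - 2 * x) * phi x)%:E)%E.
Proof.
move=> ab dphi cphi'.
have cphi := derivable_continuous _ _ dphi.
pose p (x : R) := (x - a) * (b - x); pose dp (x : R) := a + b - 2 * x.
have dpE (x : R) : is_derive x (1 : R) p (dp x).
  rewrite /p /dp; apply: is_derive_eq; rewrite /GRing.scale /=; ring.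
have cp : continuous p by apply: derivable_continuous => x; exact: ex_derive.
have cdp : continuous dp.
  apply: derivable_continuous => x; rewrite /dp; exact: ex_derive.
have cM (f g : R -> R) : continuous f -> continuous g ->
    continuous (fun x => f x * g x).
  by move=> cf cg x; apply: cvgM; [exact: cf|exact: cg].
have mc (f : R -> R) : continuous f -> measurable_fun `[a, b[ (EFin \o f).
  move=> cf; apply/measurable_EFinP; apply: measurable_funTS.
  exact: continuous_measurable_fun.
have LR (f : R -> R) : (forall x, derivable f x 1) ->
    derivable_oo_LRcontinuous f a b.
  move=> df; have cf := derivable_continuous _ _ df.
  split; first by move=> x _; exact: df.
    exact/cvg_at_right_filter/cf.
  exact/cvg_at_left_filter/cf.
have int1 : mu.-integrable `[a, b] (EFin \o (fun x => dp x * phi x)).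
  apply: continuous_compact_integrable; first exact: segment_compact.
  exact/continuous_subspaceT/cM.
rewrite !integral_itv_bndo_bndc;
  [|exact: (mc _ (cM _ _ cp cphi'))|exact: (mc _ (cM _ _ cdp cphi))].
split; first exact: integrable_fin_num.
rewrite (@integration_by_parts _ p phi dp (phi^`())%classic) //.
- by rewrite /p !subrr !(mulr0, mul0r) subrr sub0e.
- exact: continuous_subspaceT.
- by apply: LR => x; exact: ex_derive.
- by move=> x _; rewrite derive1E; exact: derive_val.
- exact: continuous_subspaceT.
- exact: LR.
Qed.

Lemma integral_glue (R : realType) (c : R ^nat) (n : nat) (u w : R -> R) :
  nondecreasing_seq c ->
  measurable_fun `[c 0%N, c n[ u -> measurable_fun `[c 0%N, c n[ w ->
  (forall i, (i < n)%N ->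
    (\int[mu]_(x in `[c i, c i.+1[) (w x)%:E \is a fin_num)%E /\
    (\int[mu]_(x in `[c i, c i.+1[) (u x)%:E =
     - \int[mu]_(x in `[c i, c i.+1[) (w x)%:E)%E) ->
  (\int[mu]_(x in `[c 0%N, c n[) (u x)%:E
   = - \int[mu]_(x in `[c 0%N, c n[) (w x)%:E)%E.
Proof.
move=> cle; elim: n => [|n IH] umeas wmeas H.
  by rewrite set_itvco0 // !integral_set0 oppe0.
have cE : `[c 0%N, c n.+1[%classic = `[c 0%N, c n[ `|` `[c n, c n.+1[.
  by rewrite -itv_bndbnd_setU // bnd_simp; exact: cle.
have dis : [disjoint `[c 0%N, c n[%classic & `[c n, c n.+1[%classic].
  apply/disj_setPS => x [/=]; rewrite !in_itv /= => /andP[_ xc] /andP[cx _].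
  by move: xc; rewrite ltNge cx.
have [wn un] := H n (ltnSn n).
rewrite cE in umeas wmeas *.
rewrite !integral_setU_EFin // fin_num_oppeD // un IH //.
- by apply: measurable_funS umeas => //; exact: measurableU.
- by apply: measurable_funS wmeas => //; exact: measurableU.
- by move=> i i_n; apply: H; rewrite ltnS ltnW.
Qed.

(** On the cell [[j, j + 1[ * 2 ^- m] containing [x], whose ends [a], [b] add up
    to [2 ^- m * (2 * j + 1)], this is [a + b - 2 * x]. The floor function
    makes it a single formula defined everywhere. *)
Definition slope (R : realType) (m : nat) (x : R) : R :=
  2 ^- m * (2 * (Num.floor (2 ^+ m * x))%:~R + 1) - 2 * x.

Lemma slope_measurable (R : realType) (m : nat) (D : set R) :
  measurable D -> measurable_fun D (slope R m).
Proof.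
move=> mD; apply: measurable_funB; last exact: measurable_funM.
apply: nondecreasing_measurable => // x y xy.
rewrite ler_pM2l ?invr_gt0 ?exprn_gt0 // lerD2r ler_pM2l // ler_int.
by apply: Num.Theory.le_floor; rewrite ler_pM2l ?exprn_gt0.
Qed.

Lemma slope_le (R : realType) (m : nat) (x : R) : `|slope R m x| <= 2 ^- m.
Proof.
have m0 : 0 < 2 ^+ m :> R by rewrite exprn_gt0.
have -> : slope R m x
    = 2 ^- m * (2 * (Num.floor (2 ^+ m * x))%:~R + 1 - 2 * (2 ^+ m * x)).
  by rewrite /slope; field; rewrite gt_eqF.
rewrite normrM gtr0_norm ?invr_gt0 // ger_pMr ?invr_gt0 // ler_norml.
have /andP[] := Num.Theory.floor_itv (2 ^+ m * x).
rewrite intrD => lo up; apply/andP; split; lra.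
Qed.

Lemma bounded_locally_integrable (R : realType) (a b : R) (f : R -> R) :
  measurable_fun `]a, b[ f -> [bounded f x | x in `]a, b[] ->
  locally_integrable `]a, b[ f.
Proof.
move=> mf bf; apply: open_integrable_locally; first exact: interval_open.
apply: measurable_bounded_integrable => //.
by rewrite /= lebesgue_measure_itv /=; case: ifP => // _; rewrite -EFinB ltry.
Qed.

(** Summing [arc_ibp] over the [2 * 2 ^ m] dyadic cells of [[-1, 1[]. *)
Lemma slope_weak_derivative (R : realType) (m : nat) :
  weak_derivative (-1) 1 (fun x => approx R m x - x ^+ 2) (slope R m).
Proof.
set v := fun x => _.
have cv : continuous v.
  by move=> x; apply: cvgB; [exact: approx_continuous|exact: exprn_continuous].
split.
- apply: bounded_locally_integrable.
    by apply: measurable_funTS; exact: continuous_measurable_fun.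
  have [M [Mr HM]] : bounded_set (v @` `[-1, 1]).
    apply: compact_bounded.
    apply: continuous_compact; last exact: segment_compact.
    exact: continuous_subspaceT.
  exists M; split => // N /HM HN x /= x1; apply: HN; exists x => //=.
  exact: subset_itv_oo_cc.
- apply: bounded_locally_integrable; first exact: slope_measurable.
  exists 1; split => // N N1 x _ /=; apply: (le_trans (slope_le _ _ _)).
  apply: le_trans (ltW N1).
  by rewrite invf_le1 ?exprn_gt0 // exprn_ege1 // ler1n.
move=> phi [dphi _ _].
have dphi0 : forall x, derivable phi x 1 by exact: (dphi 0%N).
have cphi := derivable_continuous _ _ dphi0.
have cphi' : continuous (phi^`())%classic.
  by apply: derivable_continuous; exact: (dphi 1%N).
have m0 : 0 < 2 ^- m :> R by rewrite invr_gt0 exprn_gt0.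
have m0' : 0 < 2 ^+ m :> R by rewrite exprn_gt0.
pose c (i : nat) : R := -1 + i%:R * 2 ^- m.
have c0 : c 0%N = -1 by rewrite /c mul0r addr0.
have cn : c (2 * 2 ^ m)%N = 1.
  by rewrite /c natrM natrX mulfK ?gt_eqF //; ring.
have mvphi : measurable_fun setT (fun x => v x * (phi^`())%classic x).
  apply: continuous_measurable_fun => x; apply: cvgM; [exact: cv|exact: cphi'].
have mw : measurable_fun setT (fun x => slope R m x * phi x).
  apply: measurable_funM; first exact: slope_measurable.
  exact: continuous_measurable_fun.
rewrite !integral_itv_obnd_cbnd;
  [|by apply/measurable_EFinP; exact: measurable_funTS..].
have cmono : nondecreasing_seq c.
  by move=> i j ij; rewrite /c lerD2l ler_pM2r // ler_nat.
have := @integral_glue R c (2 * 2 ^ m)%N _ _ cmono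
  (measurable_funTS mvphi) (measurable_funTS mw).
rewrite c0 cn; apply => i lt_i.
have ci : -1 <= c i by rewrite -c0; exact: cmono.
have ci1 : c i.+1 <= 1 by rewrite -cn; exact: cmono.
have cci : c i < c i.+1 by rewrite /c ltrD2l ltr_pM2r // ltr_nat.
(* [j] numbers the cell from the origin, [i] from the left end [-1]. *)
pose j : int := i%:Z - (2 ^ m)%:Z.
have jE : j%:~R = 2 ^+ m * c i.
  by rewrite /j intrB /c -!pmulrn natrX; field; rewrite gt_eqF.
have jE1 : j%:~R + 1 = 2 ^+ m * c i.+1.
  by rewrite jE /c -natr1; field; rewrite gt_eqF.
have vE x : x \in `[c i, c i.+1[ -> v x = (x - c i) * (c i.+1 - x).
  rewrite in_itv /= => /andP[cx xc].
  have x1 : `|x| <= 1 by rewrite ler_norml; apply/andP; split; lra.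
  rewrite /v approx_error // (saw_bump _ _ _ j x1); last first.
    by rewrite jE1 jE !ler_pM2l // cx ltW.
  have -> : 4 ^- m = 2 ^- m * 2 ^- m :> R by rewrite -invfM -exprMn -natrM.
  by rewrite jE1 jE; field; rewrite gt_eqF.
have gE x : x \in `[c i, c i.+1[ -> slope R m x = c i + c i.+1 - 2 * x.
  rewrite in_itv /= => /andP[cx xc].
  have -> : slope R m x = 2 ^- m * (2 * j%:~R + 1) - 2 * x.
    rewrite /slope; congr (_ * (_ * _%:~R + _) - _).
    apply: Num.Theory.floor_def.
    by rewrite intrD jE1 jE ler_pM2l // ltr_pM2l // cx.
  have -> : 2 * j%:~R + 1 = j%:~R + (j%:~R + 1) :> R by ring.
  by rewrite jE1 jE -mulrDr mulKf ?gt_eqF.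
have [intfin eqn] := arc_ibp _ (c i) (c i.+1) phi cci dphi0 cphi'.
have gI : (\int[mu]_(x in `[c i, c i.+1[) (slope R m x * phi x)%:E =
    \int[mu]_(x in `[c i, c i.+1[) ((c i + c i.+1 - 2 * x) * phi x)%:E)%E.
  by apply: eq_integral => x; rewrite inE => /gE ->.
split; first by rewrite gI.
transitivity (\int[mu]_(x in `[c i, c i.+1[)
    ((x - c i) * (c i.+1 - x) * (phi^`())%classic x)%:E)%E.
  by apply: eq_integral => x; rewrite inE => /vE ->.
by rewrite eqn gI.
Qed.

Theorem theorem3p1 (R : realType) (L : nat) (hL : (0 < L)%N) :
  exists2 f : 'rV[R]_1 -> R, Nhat R 1 L 3 f &
    Linfty_norm `[-1, 1] (fun x : R => f (const_mx x) - x ^+ 2)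
      = (2 ^- (2 * L))%:E /\
    (W1oo_seminorm (-1)%R 1%R (fun x : R => f (const_mx x) - x ^+ 2)%R
      <= (2 ^- (L - 1))%:E)%E.
Proof.
case: L hL => // m _; rewrite subn1 /=.
exists (fun x => approx R m (x 0 0)); first exact: approx_Nhat.
have -> : (fun x : R => approx R m ((const_mx x : 'rV[R]_1) 0 0) - x ^+ 2)
    = (fun x => approx R m x - x ^+ 2).
  by apply/funext => x; rewrite mxE.
split; first exact: approx_Linfty.
apply: (@le_trans _ _ (Linfty_norm `]-1, 1[ (slope R m))).
  apply: ereal_inf_lbound; exists (slope R m) => //.
  exact: slope_weak_derivative.
apply: Linfty_norm_le => [|x _]; last exact: slope_le.
by rewrite invr_ge0 exprn_ge0.
Qed.
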